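(* Let $n\geq 3$, let $t$ be an indeterminate, and let $\eta_1:T_n\rightarrow\mathrm{GL}_n(\mathbb{Z}[t^{\pm1}])$ be the representation of the twin group given by $\eta_1(s_i)=\left(\begin{array}{c|c|c} I_{i-1} & 0 & 0\\ \hline 0 & \begin{matrix}1-t & t\\ 2-t & t-1\end{matrix} & 0\\ \hline 0&0&I_{n-i-1}\end{array}\right)$ for $1\leq i\leq n-1$. Then there is no $2$-local extension of $\eta_1$ to the welded twin group $WT_n$; that is, there is no $2$-local representation $\hat\eta_1:WT_n\to\mathrm{GL}_n(\mathbb{Z}[t^{\pm1}])$ with $\hat\eta_1(s_i)=\eta_1(s_i)$ for all $1\leq i\leq n-1$.
   Context: The twin group $T_n$ has generators $s_1,\ldots,s_{n-1}$ and relations $s_i^2=1$ ($1\le i\le n-1$), $s_is_j=s_js_i$ ($|i-j|\geq2$). The welded twin group $WT_n$ has generators $s_1,\ldots,s_{n-1},\rho_1,\ldots,\rho_{n-1}$, with the relations of $T_n$ together with: $\rho_i\rho_{i+1}\rho_i=\rho_{i+1}\rho_i\rho_{i+1}$ ($1\le i\le n-2$); $\rho_i\rho_j=\rho_j\rho_i$ ($|i-j|\geq 2$); $\rho_i^2=1$ ($1\le i\le n-1$); $s_i\rho_j=\rho_js_i$ ($|i-j|\geq2$); $\rho_i\rho_{i+1}s_i=s_{i+1}\rho_i\rho_{i+1}$ ($1\le i\le n-2$); $\rho_is_{i+1}s_i=s_{i+1}s_i\rho_{i+1}$ ($1\le i\le n-2$). A representation $\theta:WT_n\to\mathrm{GL}_n(\mathbb{Z}[t^{\pm1}])$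 is $2$-local if for each $1\leq i\leq n-1$ there are $M_i,N_i\in\mathrm{GL}_2(\mathbb{Z}[t^{\pm1}])$ with $\theta(s_i)=\mathrm{diag}(I_{i-1},M_i,I_{n-i-1})$ and $\theta(\rho_i)=\mathrm{diag}(I_{i-1},N_i,I_{n-i-1})$ (block diagonal). $I_r$ is the $r\times r$ identity matrix. *)

(* Defs.v *)
From HB Require Import structures.
From mathcomp Require Import all_boot all_order all_algebra.
From mathcomp Require Import fraction.
From mathcomp Require Import boolp.
From mathcomp Require Import ring zify.

Set Implicit Arguments.
Unset Strict Implicit.
Unset Printing Implicit Defensive.

Import GRing.Theory.
Import IntDist.

Local Open Scope ring_scope.
Local Open Scope quotient_scope.

(* The generators s_1, ..., s_(n-1) are indexed from 0: i : 'I_n.-1 stands   *)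
(* for the 1-based index i + 1, so that |i - j| and "j = i + 1" are unchanged *)
(* while diag(I_(i-1), M, I_(n-i-1)) becomes diag(I_i, M, I_(n-(i+2))).       *)

(* The letter (x, false) is x, and (x, true) is its formal inverse.           *)
Definition word (X : Type) := seq (X * bool).

Section Presentation.
Variables (X : choiceType) (R : word X -> word X -> Prop).

(* The smallest congruence on words containing free reduction and R. *)
Inductive word_eq : word X -> word X -> Prop :=
| WeRefl u : word_eq u u
| WeSym u v : word_eq u v -> word_eq v u
| WeTrans u v w : word_eq u v -> word_eq v w -> word_eq u w
| WeCat u u' v v' :
    word_eq u u' -> word_eq v v' -> word_eq (u ++ v) (u' ++ v')
| WeCancel x b : word_eq [:: (x, b); (x, ~~ b)] [::]
| WeRel u v : R u v -> word_eq u v.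

Definition word_eqb (u v : word X) : bool := `[< word_eq u v >].

Lemma word_eqb_refl : reflexive word_eqb.
Proof. by move=> u; apply/asboolP; apply: WeRefl. Qed.

Lemma word_eqb_sym : symmetric word_eqb.
Proof. by move=> u v; apply/asboolP/asboolP; apply: WeSym. Qed.

Lemma word_eqb_trans : transitive word_eqb.
Proof.
by move=> v u w /asboolP uv /asboolP vw; apply/asboolP; apply: WeTrans vw.
Qed.

Canonical word_equiv :=
  EquivRel word_eqb word_eqb_refl word_eqb_sym word_eqb_trans.

Definition pres : Type := {eq_quot word_equiv}.
HB.instance Definition _ := Choice.on pres.

Definition pclass (u : word X) : pres := \pi_({eq_quot word_equiv}) u.

Lemma pclassP u v : pclass u = pclass v <-> word_eq u v.
Proof. by split=> [/eqquotP/asboolP|uv] //; apply/eqquotP/asboolP. Qed.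

Lemma pclass_repr (x : pres) : pclass (repr x) = x.
Proof. exact: reprK. Qed.

Definition word_inv (u : word X) : word X :=
  rev [seq (p.1, ~~ p.2) | p <- u].

Lemma word_invK : involutive word_inv.
Proof.
move=> u; rewrite /word_inv map_rev revK -map_comp -[RHS]map_id.
by apply: eq_map => -[x b] /=; rewrite negbK.
Qed.

Lemma word_eq_catV u : word_eq (u ++ word_inv u) [::].
Proof.
elim: u => [|[x b] u IHu]; first exact: WeRefl.
apply: WeTrans _ (WeCancel x b).
have -> : ((x, b) :: u) ++ word_inv ((x, b) :: u) =
    [:: (x, b)] ++ ((u ++ word_inv u) ++ [:: (x, ~~ b)]).
  by rewrite /word_inv /= rev_cons -cats1 catA.
exact: (@WeCat [:: (x, b)] _ _ [:: (x, ~~ b)] (WeRefl _)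
          (WeCat IHu (WeRefl _))).
Qed.

Lemma word_eq_Vcat u : word_eq (word_inv u ++ u) [::].
Proof. by rewrite -{2}[u]word_invK; apply: word_eq_catV. Qed.

Definition pres_one : pres := pclass [::].
Definition pres_mul (x y : pres) : pres := pclass (repr x ++ repr y).
Definition pres_inv (x : pres) : pres := pclass (word_inv (repr x)).

Lemma word_eq_repr u : word_eq (repr (pclass u)) u.
Proof. by apply/pclassP; apply: pclass_repr. Qed.

Lemma pclassM u v : pclass (u ++ v) = pres_mul (pclass u) (pclass v).
Proof. by apply/pclassP; apply: WeSym; apply: WeCat; apply: word_eq_repr. Qed.

Lemma pres_mulA : associative pres_mul.
Proof.
move=> x y z; rewrite -[x]pclass_repr -[y]pclass_repr -[z]pclass_repr.
by rewrite -!pclassM catA.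
Qed.

Lemma pres_mul1 : left_id pres_one pres_mul.
Proof. by move=> x; rewrite -[x]pclass_repr -pclassM. Qed.

Lemma pres_mulr1 : right_id pres_one pres_mul.
Proof. by move=> x; rewrite -[x]pclass_repr -pclassM cats0. Qed.

Lemma pres_mulV : left_inverse pres_one pres_inv pres_mul.
Proof.
move=> x; rewrite -{2}[x]pclass_repr -pclassM.
by apply/pclassP; apply: word_eq_Vcat.
Qed.

Lemma pres_mulrV : right_inverse pres_one pres_inv pres_mul.
Proof.
move=> x; rewrite -{1}[x]pclass_repr -pclassM.
by apply/pclassP; apply: word_eq_catV.
Qed.

HB.instance Definition _ := isGroup.Build pres
  pres_mulA pres_mul1 pres_mulr1 pres_mulV pres_mulrV.

Lemma pclassMg u v : pclass (u ++ v) = (pclass u * pclass v)%g.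
Proof. exact: pclassM. Qed.

Definition pgen (x : X) : pres := pclass [:: (x, false)].

Section Lift.
Variables (H : groupType) (f : X -> H).

Definition word_eval (u : word X) : H :=
  (\prod_(p <- u) (if p.2 then (f p.1)^-1 else f p.1))%g.

Hypothesis fR : forall u v, R u v -> word_eval u = word_eval v.

Lemma word_evalP u v : word_eq u v -> word_eval u = word_eval v.
Proof.
elim=> {u v} [u|u v _ ->|u v w _ -> _ ->|u u' v v' _ eu _ ev|x b|u v /fR] //.
  by rewrite /word_eval !big_cat -!/(word_eval _) eu ev.
rewrite /word_eval !big_cons big_nil /= mulg1.
by case: b; rewrite /= ?mulVg ?mulgV.
Qed.

(* The argument fR is kept as a parameter so that the morphism structure can  *)
(* be attached to pres_lift.                                                  *)
Definition pres_lift
  of (forall u v, R u v -> word_eval u = word_eval v) : pres -> H :=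
  fun x => word_eval (repr x).

Lemma pres_lift_class u : pres_lift fR (pclass u) = word_eval u.
Proof. exact/word_evalP/word_eq_repr. Qed.

Lemma pres_lift_gen x : pres_lift fR (pgen x) = f x.
Proof. by rewrite pres_lift_class /word_eval big_seq1. Qed.

Lemma pres_liftM : {morph pres_lift fR : x y / (x * y)%g}.
Proof.
move=> x y; rewrite -[x]pclass_repr -[y]pclass_repr -pclassMg !pres_lift_class.
by rewrite /word_eval big_cat.
Qed.

HB.instance Definition _ := isMultiplicative.Build pres H (pres_lift fR)
  pres_liftM.

End Lift.

End Presentation.

Section TwinGroups.
Variable n : nat.

Inductive twin_rel : word 'I_n.-1 -> word 'I_n.-1 -> Prop :=
| TwSq (i : 'I_n.-1) :
    twin_rel [:: (i, false); (i, false)] [::]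
| TwComm (i j : 'I_n.-1) : (2 <= `|i - j|)%N ->
    twin_rel [:: (i, false); (j, false)] [:: (j, false); (i, false)].

Definition twin := pres twin_rel.
Definition tw_s (i : 'I_n.-1) : twin := pgen twin_rel i.

Local Notation wgen := ('I_n.-1 + 'I_n.-1)%type.
Local Notation s i := (inl i, false).
Local Notation r i := (inr i, false).

Inductive wtwin_rel : word wgen -> word wgen -> Prop :=
| WtSSq (i : 'I_n.-1) :
    wtwin_rel [:: s i; s i] [::]
| WtSComm (i j : 'I_n.-1) : (2 <= `|i - j|)%N ->
    wtwin_rel [:: s i; s j] [:: s j; s i]
| WtRBraid (i j : 'I_n.-1) : j = i.+1 :> nat ->
    wtwin_rel [:: r i; r j; r i] [:: r j; r i; r j]
| WtRComm (i j : 'I_n.-1) : (2 <= `|i - j|)%N ->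
    wtwin_rel [:: r i; r j] [:: r j; r i]
| WtRSq (i : 'I_n.-1) :
    wtwin_rel [:: r i; r i] [::]
| WtSRComm (i j : 'I_n.-1) : (2 <= `|i - j|)%N ->
    wtwin_rel [:: s i; r j] [:: r j; s i]
| WtRRS (i j : 'I_n.-1) : j = i.+1 :> nat ->
    wtwin_rel [:: r i; r j; s i] [:: s j; r i; r j]
| WtRSS (i j : 'I_n.-1) : j = i.+1 :> nat ->
    wtwin_rel [:: r i; s j; s i] [:: s j; s i; r j].

Definition wtwin := pres wtwin_rel.
Definition wt_s (i : 'I_n.-1) : wtwin := pgen wtwin_rel (inl i).
Definition wt_rho (i : 'I_n.-1) : wtwin := pgen wtwin_rel (inr i).

End TwinGroups.

HB.instance Definition _ n := Group.on (twin n).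
HB.instance Definition _ n := Group.on (wtwin n).

Local Notation tofrac := (@FracField.tofrac {poly int}).
Local Notation "p %:F" := (tofrac p).

(* Z[t, t^-1] is realised inside the field of rational functions, as the set  *)
(* of the fractions p / t^k.                                                  *)
Definition laurent_pred : {pred {fraction {poly int}}} :=
  fun x => `[< exists (p : {poly int}) (k : nat), x = p%:F / ('X ^+ k)%:F >].

Lemma laurentP x :
  reflect (exists (p : {poly int}) (k : nat), x = p%:F / ('X ^+ k)%:F)
    (x \in laurent_pred).
Proof. exact: asboolP. Qed.

Lemma tofracX_neq0 k : ('X ^+ k : {poly int})%:F != 0.
Proof. by rewrite tofrac_eq0 expf_neq0 ?polyX_eq0. Qed.

Lemma laurent_poly (p : {poly int}) : p%:F \in laurent_pred.
Proof. by apply/laurentP; exists p, 0%N; rewrite expr0 tofrac1 divr1. Qed.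

Lemma laurent_subring : subring_closed laurent_pred.
Proof.
split=> [|x y /laurentP[p [k ->]] /laurentP[q [l ->]]|
         x y /laurentP[p [k ->]] /laurentP[q [l ->]]].
- by rewrite -tofrac1 laurent_poly.
- apply/laurentP; exists (p * 'X ^+ l - q * 'X ^+ k), (k + l)%N.
  rewrite -mulNr addf_div ?tofracX_neq0 // exprD tofracB !tofracM mulNr.
  by [].
- apply/laurentP; exists (p * q), (k + l)%N.
  by rewrite mulf_div exprD !tofracM.
Qed.

HB.instance Definition _ :=
  GRing.isSubringClosed.Build _ laurent_pred laurent_subring.

Record laurent := Laurent {
  laurent_val :> {fraction {poly int}};
  laurent_valP : laurent_val \in laurent_pred
}.

HB.instance Definition _ := [isSub for laurent_val].
HB.instance Definition _ := [Choice of laurent by <:].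
HB.instance Definition _ := [SubChoice_isSubComNzRing of laurent by <:].

Definition laurent_unit : {pred laurent} :=
  fun x => (val x != 0) && ((val x)^-1 \in laurent_pred).
Definition laurent_inv (x : laurent) : laurent :=
  if x \in laurent_unit then insubd x (val x)^-1 else x.

Lemma laurent_mulV : {in laurent_unit, left_inverse 1 laurent_inv *%R}.
Proof.
move=> x xU; apply: val_inj; rewrite /laurent_inv xU rmorphM rmorph1 /=.
by case/andP: xU => x0 xV; rewrite -[laurent_val _]/(val _) insubdK // mulVf.
Qed.

Lemma laurent_unitP x y : y * x = 1 -> x \in laurent_unit.
Proof.
move=> /(congr1 val); rewrite rmorphM rmorph1 /= => yx1.
have x0 : val x != 0.
  by apply/eqP => x0; move/eqP: yx1; rewrite [laurent_val x]x0 mulr0 eq_sym oner_eq0.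
rewrite unfold_in x0 /=; suff -> : (val x)^-1 = val y by exact: valP.
by apply: (mulIf x0); rewrite mulVf // -yx1.
Qed.

Lemma laurent_inv_out : {in [predC laurent_unit], laurent_inv =1 id}.
Proof. by move=> x /negPf xU; rewrite /laurent_inv xU. Qed.

HB.instance Definition _ := GRing.ComNzRing_hasMulInverse.Build laurent
  laurent_mulV laurent_unitP laurent_inv_out.

Definition laurent_t : laurent := Laurent (laurent_poly 'X).

Section GL.
Variables (n : nat) (R : comUnitRingType).

Record GL := MkGL { GLmx :> 'M[R]_n; GLmxP : GLmx \in unitmx }.

HB.instance Definition _ := [isSub for GLmx].
HB.instance Definition _ := [Choice of GL by <:].

Definition GL_one : GL := MkGL (unitmx1 R n).

Fact GL_mul_subproof (A B : GL) : (A : 'M_n) *m B \in unitmx.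
Proof. by rewrite unitmx_mul !GLmxP. Qed.
Definition GL_mul (A B : GL) : GL := MkGL (GL_mul_subproof A B).

Fact GL_inv_subproof (A : GL) : invmx A \in unitmx.
Proof. by rewrite unitmx_inv GLmxP. Qed.
Definition GL_inv (A : GL) : GL := MkGL (GL_inv_subproof A).

Lemma GL_mulA : associative GL_mul.
Proof. by move=> A B C; apply: val_inj; apply: mulmxA. Qed.
Lemma GL_mul1 : left_id GL_one GL_mul.
Proof. by move=> A; apply: val_inj; apply: mul1mx. Qed.
Lemma GL_mulr1 : right_id GL_one GL_mul.
Proof. by move=> A; apply: val_inj; apply: mulmx1. Qed.
Lemma GL_mulV : left_inverse GL_one GL_inv GL_mul.
Proof. by move=> A; apply: val_inj; apply: mulVmx (GLmxP A). Qed.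
Lemma GL_mulrV : right_inverse GL_one GL_inv GL_mul.
Proof. by move=> A; apply: val_inj; apply: mulmxV (GLmxP A). Qed.

HB.instance Definition _ := isGroup.Build GL
  GL_mulA GL_mul1 GL_mulr1 GL_mulV GL_mulrV.
End GL.

Section Local2.
Variables (n : nat) (R : comUnitRingType).

Fact local2_dim (i : 'I_n.-1) : (i + 2 + (n - (i + 2)) = n)%N.
Proof. by rewrite subnKC // addn2 -ltn_predRL. Qed.

Definition local2 (i : 'I_n.-1) (M : 'M[R]_2) : 'M[R]_n :=
  castmx (local2_dim i, local2_dim i)
    (block_mx (block_mx 1%:M 0 0 M : 'M_(i + 2)) 0
              0 (1%:M : 'M_(n - (i + 2)))).

Lemma local2_1 i : local2 i 1%:M = 1%:M.
Proof.
rewrite /local2 -!scalar_mx_block; move: (local2_dim i) => e.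
have cast1 m (e' : m = n) : castmx (e', e') (1%:M : 'M[R]_m) = 1%:M.
  by case: _ / e'; rewrite castmx_id.
exact: cast1.
Qed.

Lemma local2M i M N : local2 i M *m local2 i N = local2 i (M *m N).
Proof.
rewrite /local2; move: (local2_dim i) => e.
have castM m (e' : m = n) (A B : 'M[R]_m) :
    castmx (e', e') A *m castmx (e', e') B = castmx (e', e') (A *m B).
  by case: _ / e'; rewrite !castmx_id.
rewrite castM !mulmx_block !(mulmx0, mul0mx, mulmx1, mul1mx, addr0, add0r).
by [].
Qed.

Lemma local2_out (i : 'I_n.-1) (M : 'M[R]_2) (a b : 'I_n) :
  ~~ (i <= a < i + 2)%N || ~~ (i <= b < i + 2)%N ->
  local2 i M a b = (a == b)%:R.
Proof.
move=> out; rewrite castmxE.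
have -> : (a == b) = (cast_ord (esym (local2_dim i)) a ==
                      cast_ord (esym (local2_dim i)) b) by [].
move: out; rewrite -[nat_of_ord a]/(nat_of_ord (cast_ord (esym (local2_dim i)) a)).
rewrite -[nat_of_ord b]/(nat_of_ord (cast_ord (esym (local2_dim i)) b)).
move: (cast_ord _ a) (cast_ord _ b) => {}a {}b.
case: (split_ordP a) => {}a ->; case: (split_ordP b) => {}b ->.
- rewrite block_mxEul eq_lshift /=.
  case: (split_ordP a) => {}a ->; case: (split_ordP b) => {}b ->.
  + by rewrite block_mxEul mxE eq_lshift.
  + by rewrite block_mxEur mxE eq_lrshift.
  + by rewrite block_mxEdl mxE eq_rlshift.
  + by move: (ltn_ord a) (ltn_ord b) => /=; lia.
- by rewrite block_mxEur mxE eq_lrshift.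
- by rewrite block_mxEdl mxE eq_rlshift.
- by rewrite block_mxEdr mxE eq_rshift.
Qed.

Lemma local2_comm (i j : 'I_n.-1) (M N : 'M[R]_2) : (2 <= `|i - j|)%N ->
  local2 i M *m local2 j N = local2 j N *m local2 i M.
Proof.
move=> far.
have mul0 (k l : 'I_n.-1) (A B : 'M[R]_2) : (2 <= `|k - l|)%N ->
    (local2 k A - 1%:M) *m (local2 l B - 1%:M) = 0.
  move=> kl; apply/matrixP => a b; rewrite !mxE big1 // => c _.
  have [/andP[kc ck]|ck] := boolP (k <= c < k + 2)%N.
    rewrite [X in _ * X]mxE local2_out ?mxE ?subrr ?mulr0 //; apply/orP; left.
    by apply/negP => /andP[lc cl]; lia.
  by rewrite mxE local2_out ?mxE ?subrr ?mul0r // ck orbT.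
have prod0 (A B : 'M[R]_n) :
    (A - 1%:M) *m (B - 1%:M) = 0 -> A *m B = B - 1%:M + A.
  rewrite mulmxBl mulmxBr mulmx1 mul1mx => /eqP.
  by rewrite subr_eq0 subr_eq => /eqP.
rewrite (prod0 _ _ (mul0 _ _ _ _ far)) prod0; last by rewrite mul0 // distnC.
by rewrite addrAC [RHS]addrAC [B in _ = B - _]addrC.
Qed.
End Local2.

Definition eta1_block : 'M[laurent]_2 :=
  let t := laurent_t in
  \matrix_(a, b) (nth [::] [:: [:: 1 - t; t];
                               [:: 2 - t; t - 1]] a)`_b.

Lemma eta1_block_sq : eta1_block *m eta1_block = 1%:M.
Proof.
apply/matrixP => a b; rewrite !mxE !big_ord_recl big_ord0 !mxE /=.
case: a => [[|[|a]] ha] //; case: b => [[|[|b]] hb] //=; by ring.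
Qed.


Section Eta1.
Variable n : nat.

Fact eta1_mx_subproof (i : 'I_n.-1) : local2 i eta1_block \in unitmx.
Proof.
by have /mulmx1_unit[] :
  local2 i eta1_block *m local2 i eta1_block = 1%:M
  by rewrite local2M eta1_block_sq local2_1.
Qed.

Definition eta1_gen (i : 'I_n.-1) : GL n laurent := MkGL (eta1_mx_subproof i).

Fact eta1_rel u v : twin_rel u v -> word_eval eta1_gen u = word_eval eta1_gen v.
Proof.
case=> [i|i j far]; rewrite /word_eval !big_cons !big_nil /= !mulg1.
  by apply: val_inj; rewrite /= local2M eta1_block_sq local2_1.
by apply: val_inj; apply: local2_comm.
Qed.

Definition eta1 : {multiplicative twin n -> GL n laurent} := pres_lift eta1_rel.

Lemma eta1E (i : 'I_n.-1) : eta1 (tw_s i) = local2 i eta1_block :> 'M_n.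
Proof.
have -> : eta1 (tw_s i) = eta1_gen i by exact: (pres_lift_gen eta1_rel).
by [].
Qed.

Definition two_local (theta : wtwin n -> GL n laurent) : Prop :=
  forall i : 'I_n.-1, exists M N : GL 2 laurent,
    theta (wt_s i) = local2 i M :> 'M_n /\ theta (wt_rho i) = local2 i N :> 'M_n.

End Eta1.

(* Main.v *)
Require Import Defs.
From mathcomp Require Import all_boot all_order all_algebra.
From mathcomp Require Import fraction ring zify.

Set Implicit Arguments.
Unset Strict Implicit.
Unset Printing Implicit Defensive.

Import GRing.Theory.
Local Open Scope ring_scope.

(** The relation rho_1 s_2 s_1 = s_2 s_1 rho_2 alone almost determines the
    blocks N, N' of rho_1, rho_2 once the s_i are given.  Both sides live in a
    window of three consecutive coordinates, and comparing 3 x 3 entries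
    ([rho_blocks]) leaves a single free parameter u: with r = 2 - t,

      N = I - u D,  N' = I - u D',
      D = [rt, -t; -r, 1],  D' = [1, -t; -r, rt].

    Both D and D' have rank one and trace 1 + rt, so D^2 = (1 + rt) D, and
    rho_1^2 = 1 says that u (2 - u (1 + rt)) = 0 ([reflect_involution]).  Two
    cases remain.
    - u = 0: then rho_1 = rho_2 = 1, so rho_1 rho_2 s_1 = s_2 rho_1 rho_2
      collapses to s_1 = s_2, but their first entries are 1 - t and 1.
    - u (1 + rt) = 2: then 1 + 2t - t^2 divides 2 in Z[t, 1/t].  At t = 4 the
      former is -7, so 7 would divide 2 * 4^k for some k
      ([laurent_ndivides2]).
*)

(** * Three-dimensional windows of local matrices *)

Section Window.
Context {n : nat} {R : comUnitRingType}.

Lemma local2_in (i : 'I_n.-1) (A : 'M[R]_2) (x y : 'I_2) (a b : 'I_n) :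
  a = (i + x)%N :> nat -> b = (i + y)%N :> nat -> local2 i A a b = A x y.
Proof.
move=> ax bY; rewrite castmxE /=.
have -> : cast_ord (esym (local2_dim i)) a = lshift _ (rshift i x).
  exact: val_inj.
have -> : cast_ord (esym (local2_dim i)) b = lshift _ (rshift i y).
  exact: val_inj.
by rewrite block_mxEul block_mxEdr.
Qed.

Lemma local2_inj (i : 'I_n.-1) : injective (local2 (R := R) i).
Proof.
move=> A B eqAB; apply/matrixP => x y.
have lt_n (z : 'I_2) : (i + z < n)%N.
  by have := ltn_ord z; have := ltn_ord i; lia.
rewrite -(@local2_in i A x y (Ordinal (lt_n x)) (Ordinal (lt_n y))) // eqAB.
exact: local2_in.
Qed.

Definition mx3 (s : seq (seq R)) : 'M[R]_3 := \matrix_(a, b) (nth [::] s a)`_b.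

Definition upper3 (A : 'M[R]_2) : 'M[R]_3 :=
  mx3 [:: [:: A 0 0; A 0 1; 0]; [:: A 1 0; A 1 1; 0]; [:: 0; 0; 1]].

Definition lower3 (A : 'M[R]_2) : 'M[R]_3 :=
  mx3 [:: [:: 1; 0; 0]; [:: 0; A 0 0; A 0 1]; [:: 0; A 1 0; A 1 1]].

Section ConsecutiveIndices.
Context {i j : 'I_n.-1}.
Hypothesis ij : j = i.+1 :> nat.

Fact window_ord_subproof (a : 'I_3) : (i + a < n)%N.
Proof. by have := ltn_ord a; have := ltn_ord j; lia. Qed.

Definition window_ord (a : 'I_3) : 'I_n := Ordinal (window_ord_subproof a).

Definition window (A : 'M[R]_n) : 'M[R]_3 := mxsub window_ord window_ord A.

(** Taking a submatrix is not multiplicative in general; here the rows of the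
    left factor that meet the window vanish outside it. *)
Lemma window_local2M (k : 'I_n.-1) (A : 'M[R]_2) (B : 'M[R]_n) :
  (i <= k <= j)%N ->
  window (local2 k A *m B) = window (local2 k A) *m window B.
Proof.
move=> ikj; have inj : injective window_ord.
  by move=> a b /(congr1 val) /= /addnI /val_inj.
apply/matrixP => a b; rewrite !mxE.
rewrite (bigID [in window_ord @: setT]) /= [X in _ + X]big1 ?addr0.
  rewrite big_imset /=; last by move=> ? ? _ _ /inj.
  by apply: eq_big => [c|c _]; rewrite ?inE ?mxE.
move=> c; case: (boolP (i <= c < i + 3)%N) => [ic|ic] cw.
  have c3 : (c - i < 3)%N by lia.
  case/imsetP: cw; exists (Ordinal c3); rewrite ?inE //; apply: val_inj => /=.
  by rewrite subnKC //; case/andP: ic.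
rewrite local2_out; last by lia.
suff /negPf-> : window_ord a != c by rewrite mul0r.
by apply: contraNneq ic => <- /=; have := ltn_ord a; lia.
Qed.

Lemma window_local2_fst (A : 'M[R]_2) : window (local2 i A) = upper3 A.
Proof.
apply/matrixP => a b; rewrite !mxE.
case: a b => [[|[|[|a]]] ha] [[|[|[|b]]] hb] //=;
  by [rewrite (@local2_in _ _ 0 0) | rewrite (@local2_in _ _ 0 1)
     |rewrite (@local2_in _ _ 1 0) | rewrite (@local2_in _ _ 1 1)
     |rewrite local2_out -?val_eqE /= ?eqn_add2l //; lia].
Qed.

Lemma window_local2_snd (A : 'M[R]_2) : window (local2 j A) = lower3 A.
Proof.
apply/matrixP => a b; rewrite !mxE.
case: a b => [[|[|[|a]]] ha] [[|[|[|b]]] hb] //=;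
  by [rewrite (@local2_in _ _ 0 0) //= ij; lia
     |rewrite (@local2_in _ _ 0 1) //= ij; lia
     |rewrite (@local2_in _ _ 1 0) //= ij; lia
     |rewrite (@local2_in _ _ 1 1) //= ij; lia
     |rewrite local2_out -?val_eqE /= ?eqn_add2l //; lia].
Qed.

End ConsecutiveIndices.
End Window.

(** * Arithmetic of Laurent polynomials *)

Local Notation tofrac := (@FracField.tofrac {poly int}).
Local Notation "p %:F" := (tofrac p).
Local Notation t := laurent_t.

Lemma laurent_mul_eq0 (x y : laurent) : x * y = 0 -> x = 0 \/ y = 0.
Proof.
move=> /(congr1 val)/eqP; rewrite rmorphM rmorph0 mulf_eq0.
by case/orP=> /eqP z; [left|right]; apply: val_inj; rewrite z rmorph0.
Qed.

Lemma laurent_mulI (x y z : laurent) : x != 0 -> x * y = x * z -> y = z.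
Proof.
move=> x0 /eqP; rewrite -subr_eq0 -mulrBr => /eqP/laurent_mul_eq0[/eqP|/eqP].
  by rewrite (negPf x0).
by rewrite subr_eq0 => /eqP.
Qed.

Lemma laurent_t_neq0 : t != 0.
Proof. by rewrite -(inj_eq val_inj) rmorph0 tofrac_eq0 polyX_eq0. Qed.

Lemma laurent_1Bt_neq0 : 1 - t != 0.
Proof.
rewrite -(inj_eq val_inj) rmorph0 rmorphB rmorph1 /= -tofrac1 -tofracB.
by rewrite tofrac_eq0 -opprB oppr_eq0 polyXsubC_eq0.
Qed.

(** The factor is 1 + 2t - t^2.  Clearing denominators turns a quotient into
    an identity p * (1 + 2X - X^2) = 2 X^k between integer polynomials.  At
    X = 4 the factor is -7, while the right-hand side is a power of 2. *)
Lemma laurent_ndivides2 (u : laurent) : u * (1 + (2 - t) * t) != 2.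
Proof.
apply/eqP => /(congr1 val); rewrite rmorphM /= => eq2.
have {}eq2 : laurent_val u * (1 + (2 - 'X) * 'X)%:F = (2 : {poly int})%:F.
  by rewrite tofracD tofracM tofracB tofrac1 (rmorph_nat tofrac 2).
have /laurentP[p [k pk]] := laurent_valP u.
have {eq2 pk} /eqP :
    (p * (1 + (2 - 'X) * 'X))%:F = ((2 : {poly int}) * 'X ^+ k)%:F.
  by rewrite [LHS]tofracM [RHS]tofracM -eq2 pk mulrAC divfK ?tofracX_neq0.
rewrite tofrac_eq => /eqP/(congr1 (horner^~ 4)).
rewrite !hornerM !hornerE => eq7.
have : (7 %| 2 * 4 ^+ k)%Z by rewrite -[2]/(1 + 1) -eq7 dvdz_mull.
rewrite dvdzE abszM abszX -[`|2|%N]/(2 ^ 1)%N -[`|4|%N]/(2 ^ 2)%N.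
by rewrite -expnM -expnD Euclid_dvdX // dvdn_prime2.
Qed.

(** * The blocks of the generators rho *)

Lemma mx2P (T : Type) (A B : 'M[T]_2) :
  A 0 0 = B 0 0 -> A 0 1 = B 0 1 -> A 1 0 = B 1 0 -> A 1 1 = B 1 1 -> A = B.
Proof.
move=> e00 e01 e10 e11; have ord2 (x : 'I_2) : x = 0 \/ x = 1.
  by case: x => [[|[|//]] ?]; [left|right]; apply: val_inj.
by apply/matrixP => a b; case: (ord2 a) => ->; case: (ord2 b) => ->.
Qed.

(** The product of the column (t, -1) and the row (2 - t, -1). *)
Definition reflect_fst : 'M[laurent]_2 :=
  \matrix_(a, b) (nth [::] [:: [:: (2 - t) * t; - t];
                               [:: t - 2; 1]] a)`_b.

(** The product of the column (1, t - 2) and the row (1, -t). *)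
Definition reflect_snd : 'M[laurent]_2 :=
  \matrix_(a, b) (nth [::] [:: [:: 1; - t];
                               [:: t - 2; (2 - t) * t]] a)`_b.

(** The hypothesis is rho_i s_(i+1) s_i = s_(i+1) s_i rho_(i+1) seen in the
    window.  Its entries are linear equations in the entries of N and N',
    which solve with the help of (1 - t)^2 + t (2 - t) = 1 and by cancelling
    t and 1 - t; the parameter u is 1 - N 1 1. *)
Lemma rho_blocks (N N' : 'M[laurent]_2) :
  upper3 N *m (lower3 eta1_block *m upper3 eta1_block) =
    lower3 eta1_block *m (upper3 eta1_block *m lower3 N') ->
  exists u, N = 1%:M - u *: reflect_fst /\ N' = 1%:M - u *: reflect_snd.
Proof.
move=> eq3; have E a b := congr1 (fun X : 'M_3 => X a b) eq3.
have E00 := E 0 0; have E01 := E 0 1; have E02 := E 0 (inord 2).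
have E10 := E 1 0; have E12 := E 1 (inord 2).
have E21 := E (inord 2) 1; have E22 := E (inord 2) (inord 2).
do [rewrite !mxE !big_ord_recl !big_ord0 !mxE !big_ord_recl !big_ord0 !mxE /=
      ?inordK //=] in E00 E01 E02 E10 E12 E21 E22.
have eq_shift (x y x' y' : laurent) : x = y -> x' - y' = x - y -> x' = y'.
  by move=> ->; rewrite subrr => /subr0_eq.
have N00 : N 0 0 = 1 - (2 - t) * N 0 1.
  apply: (laurent_mulI laurent_1Bt_neq0).
  by apply: (eq_shift _ _ _ _ E00); ring.
have N'01 : N' 0 1 = N 0 1.
  apply: (laurent_mulI laurent_t_neq0).
  by apply/esym/(eq_shift _ _ _ _ E02); ring.
have N01 : N 0 1 = t * (1 - N' 0 0).
  by move: E01; rewrite N00 => E01; apply/esym/(eq_shift _ _ _ _ E01); ring.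
have N10 : N 1 0 = (2 - t) * (1 - N 1 1).
  apply: (laurent_mulI laurent_1Bt_neq0).
  by apply: (eq_shift _ _ _ _ E10); ring.
have N'10 : N' 1 0 = (2 - t) * (1 - N' 0 0).
  apply: (laurent_mulI laurent_1Bt_neq0).
  by apply: (eq_shift _ _ _ _ E21); ring.
have N'11 : N' 1 1 = 1 - (2 - t) * N' 0 1.
  apply: (laurent_mulI laurent_1Bt_neq0).
  by apply: (eq_shift _ _ _ _ E22); ring.
have N'00 : N' 0 0 = N 1 1.
  apply: (laurent_mulI laurent_t_neq0).
  move: E12; rewrite N'11 N'01 N01 => E12.
  by apply/esym/(eq_shift _ _ _ _ E12); ring.
exists (1 - N 1 1); split; apply: mx2P; rewrite !mxE /=;
  by rewrite ?N00 ?N10 ?N'10 ?N'11 ?N'01 ?N01 ?N'00; ring.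
Qed.

(** The lower right entry of [reflect_fst] is 1, so that entry of the square
    of I - u D is 1 - 2u + u^2 (1 + (2 - t) t). *)
Lemma reflect_involution (u : laurent) (N : 'M[laurent]_2) :
  N = 1%:M - u *: reflect_fst -> N *m N = 1%:M ->
  u = 0 \/ u * (1 + (2 - t) * t) = 2.
Proof.
move=> -> /(congr1 (fun X : 'M_2 => X 1 1)).
rewrite !mxE !big_ord_recl big_ord0 !mxE /= => E11.
have /laurent_mul_eq0[u0|u2] : u * (u * (1 + (2 - t) * t) - 2) = 0.
- by move/eqP: E11; rewrite -subr_eq0 => /eqP <-; ring.
- by left.
- by right; apply: subr0_eq.
Qed.

(** * Relations of the welded twin group *)

Lemma pclass2 (X : choiceType) (R : word X -> word X -> Prop) (x y : X) :
  pclass R [:: (x, false); (y, false)] = (pgen R x * pgen R y)%g.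
Proof. exact: (pclassMg R [:: _] [:: _]). Qed.

Lemma pclass3 (X : choiceType) (R : word X -> word X -> Prop) (x y z : X) :
  pclass R [:: (x, false); (y, false); (z, false)] =
    (pgen R x * (pgen R y * pgen R z))%g.
Proof. by rewrite -pclass2; apply: (pclassMg R [:: _] [:: _; _]). Qed.

Section Relations.
Variables (n : nat) (i j : 'I_n.-1).

Lemma wt_rho_sq : (wt_rho i * wt_rho i)%g = 1%g.
Proof. by rewrite /wt_rho -pclass2; apply/pclassP/WeRel/WtRSq. Qed.

Hypothesis ij : j = i.+1 :> nat.

Lemma wt_rho_s_s :
  (wt_rho i * (wt_s j * wt_s i))%g = (wt_s j * (wt_s i * wt_rho j))%g.
Proof. by rewrite /wt_rho /wt_s -!pclass3; apply/pclassP/WeRel/WtRSS. Qed.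

Lemma wt_rho_rho_s :
  (wt_rho i * (wt_rho j * wt_s i))%g = (wt_s j * (wt_rho i * wt_rho j))%g.
Proof. by rewrite /wt_rho /wt_s -!pclass3; apply/pclassP/WeRel/WtRRS. Qed.

End Relations.

Theorem theorem14 (n : nat) (hn : (3 <= n)%N) :
  ~ exists theta : {multiplicative wtwin n -> GL n laurent},
      two_local theta /\
      (forall i : 'I_n.-1, theta (wt_s i) = eta1 n (tw_s i)).
Proof.
case=> theta [loc ext].
have lt0 : (0 < n.-1)%N by lia.
have lt1 : (1 < n.-1)%N by lia.
pose i := Ordinal lt0; pose j := Ordinal lt1.
have ij : j = i.+1 :> nat by [].
have [_ [N [_ rho_i]]] := loc i; have [_ [N' [_ rho_j]]] := loc j.
have s_E k : theta (wt_s k) = local2 k eta1_block :> 'M_n.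
  by rewrite ext eta1E.
(* [theta] is only assumed to preserve products. *)
have theta1 : theta 1%g = 1%g.
  by apply: (mulgI (theta 1%g)); rewrite -gmulfM !mulg1.
have N_sq : (N : 'M_2) *m N = 1%:M.
  apply: (@local2_inj _ _ i); rewrite -local2M -rho_i local2_1.
  have := congr1 (fun x => theta x : 'M_n) (wt_rho_sq i).
  by rewrite gmulfM theta1.
have [u [NE N'E]] : exists u, (N : 'M_2) = 1%:M - u *: reflect_fst /\
    (N' : 'M_2) = 1%:M - u *: reflect_snd.
  apply: rho_blocks.
  rewrite -!(window_local2_fst ij) -!(window_local2_snd ij).
  rewrite -!window_local2M //= -?rho_i -?rho_j -?s_E.
  have := congr1 (fun x => theta x : 'M_n) (wt_rho_s_s ij).
  by rewrite !gmulfM => /= ->.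
have [u0|/eqP] := reflect_involution NE N_sq; last first.
  by rewrite (negPf (laurent_ndivides2 u)).
have rho1 k (A : 'M_2) :
    theta (wt_rho k) = local2 k (1%:M - u *: A) :> 'M_n ->
    theta (wt_rho k) = 1%:M :> 'M_n.
  by move=> ->; rewrite u0 scale0r subr0 local2_1.
have := congr1 (fun x => theta x : 'M_n) (wt_rho_rho_s ij).
rewrite !gmulfM /= (rho1 i reflect_fst) -?NE // (rho1 j reflect_snd) -?N'E //.
rewrite !mul1mx mulmx1 !s_E.
have lt0n : (0 < n)%N by lia.
move/(congr1 (fun X : 'M_n => X (Ordinal lt0n) (Ordinal lt0n))).
rewrite (@local2_in _ _ _ _ 0 0) // local2_out // eqxx mxE /=.
move/(congr1 (fun x => 1 - x)); rewrite subrr opprB addrC subrK.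
by move/eqP; rewrite (negPf laurent_t_neq0).
Qed.
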